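(* Let $\Omega_1,\Omega_2\subseteq\mathbb{R}^n$ be open sets, let $(\gamma_k)_{k=0}^\infty$ be a Riesz basis of $L^2(\Omega_1)$ and denote by $(\tilde\gamma_k)_{k=0}^\infty$ its dual. Let $h:\Omega_2\to\Omega_1$ be a non-singular measurable mapping such that $(C_h\gamma_k)_{k=0}^\infty$ is a Riesz basis of $L^2(\Omega_2)$. Then $(M_{g_{h^{-1}}}C_h\tilde\gamma_k)_{k=0}^\infty$ is the bi-orthogonal dual of $(C_h\gamma_k)_{k=0}^\infty$.
   Context: $\Omega_1,\Omega_2$ are equipped with their Borel $\sigma$-algebras $\mathcal{B}(\Omega_1),\mathcal{B}(\Omega_2)$ and Lebesgue measure $\mu$. All functions are real-valued. A measurable mapping $h:\Omega_2\to\Omega_1$ is non-singular if $\mu(B)=0$ implies $\mu(h^{-1}(B))=0$ for every $B\in\mathcal{B}(\Omega_1)$. It induces the linear map $C_hf:=f\circ h$ from $L^2(\Omega_1)$ to the space $L(\Omega_2)$ of measurable functions on $\Omega_2$. For a measurable function $k$ on $\Omega_2$, the multiplication operator $M_k$ is $M_kf(x):=k(x)f(x)$ for $f\in L^2(\Omega_2)$, $x\in\Omega_2$. A Riesz basis of $L^2(\Omega)$ is a sequence of the form $(Ue_k)_{k=0}^\infty$, where $(e_k)_{k=0}^\infty$ is an orthonormal basis of a Hilbert space $L^2(\Omega')$ ($\Omega'\subseteq\mathbb{R}^n$ open) and $U:L^2(\Omega')\to L^2(\Omega)$ is a bounded bijective linear operator. The (bi-orthogonal) dual of a Riesz basis $(\phi_k)_{k=0}^\infty$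 of $L^2(\Omega)$ is the Riesz basis $(\tilde\phi_k)_{k=0}^\infty$ of $L^2(\Omega)$ satisfying $\langle\tilde\phi_k,\phi_m\rangle_{\Omega}=\delta_{km}$ for all $k,m$ and $f=\sum_{k=0}^\infty\langle f,\tilde\phi_k\rangle_{\Omega}\,\phi_k$ for every $f\in L^2(\Omega)$, where $\langle\cdot,\cdot\rangle_\Omega$ is the inner product of $L^2(\Omega)$. When $(C_h\gamma_k)_{k=0}^\infty$ is a Riesz basis of $L^2(\Omega_2)$, the mapping $h$ is bijective in the following a.e. sense: there is a measurable $h^{-1}:\Omega_1\to\Omega_2$ with $h^{-1}\circ h(x)=x$ for a.e. $x\in\Omega_2$ and $h\circ h^{-1}(y)=y$ for a.e. $y\in\Omega_1$. The function $g_{h^{-1}}$ denotes the Radon-Nikodym derivative with respect to $\mu$ of the push-forward measure $h^{-1}_\#\mu$ on $\Omega_2$, where $h^{-1}_\#\mu(B):=\mu\bigl((h^{-1})^{-1}(B)\bigr)=\mu(\{y\in\Omega_1: h^{-1}(y)\in B\})$ for $B\in\mathcal{B}(\Omega_2)$; in this situation $g_{h^{-1}}\in L^\infty(\Omega_2)$, so that $M_{g_{h^{-1}}}$ is a bounded operator from $L^2(\Omega_2)$ into itself. *)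

(* Defs.v *)
From HB Require Import structures.
From mathcomp Require Import all_boot all_order all_algebra.
From mathcomp Require Import all_classical all_reals all_analysis.
Set Implicit Arguments.
Unset Strict Implicit.
Unset Printing Implicit Defensive.
Import Order.TTheory GRing.Theory Num.Theory.
Import numFieldNormedType.Exports.

Local Open Scope classical_set_scope.
Local Open Scope ring_scope.

(* The Borel sigma-algebra of R^n. *)
HB.instance Definition _ (R : realType) (n : nat) :=
  @isMeasurable.Build (sigma_display (@open 'rV[R]_n)) 'rV[R]_n
    <<s @open 'rV[R]_n >> (@sigma_algebra0 _ setT _)
    (@sigma_algebraC _ _) (@sigma_algebra_bigcup _ setT _).

Section borel_rV.
Context (R : realType).

Lemma measurable_rV_coord n (i : 'I_n) :
  measurable_fun [set: 'rV[R]_n] (fun v : 'rV[R]_n => v ord0 i).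
Proof.
apply: (measurability _ (measurable_realfun.RGenOpens.measurableE R)).
move=> _ [_ [a [b ->]] <-]; rewrite setTI; apply: sub_sigma_algebra.
exact: (open_comp (fun x _ => @coord_continuous R 1 n ord0 i x) (interval_open _ _)).
Qed.

Lemma measurable_fun_rV d (T : measurableType d) n (f : T -> 'rV[R]_n) :
  (forall i, measurable_fun setT (fun t => f t ord0 i)) ->
  measurable_fun setT f.
Proof.
move=> mf; apply: (@measurability _ _ _ _ _ _ (@open 'rV[R]_n)) => //.
move=> _ [U oU <-]; rewrite setTI.
pose box (q : 'rV[rat]_n * 'rV[rat]_n) : set 'rV[R]_n :=
  [set v | forall i, v ord0 i \in `]ratr (q.1 ord0 i), ratr (q.2 ord0 i)[].
have -> : f @^-1` U = \bigcup_(q in [set q | box q `<=` U]) (f @^-1` box q).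
  apply/seteqP; split => [t Uft|t [q qU]]; last exact: qU.
  have := oU; rewrite openE => /(_ _ Uft) -[P nP PU].
  have /choice[e eP] : forall i, exists e : R, 0 < e /\ ball (f t ord0 i) e `<=` P ord0 i.
    move=> i; have /nbhs_ballP[e /= e0 eP] := nP ord0 i; by exists e.
  have /choice[a aP] : forall i, exists q : rat, ratr q \in `]f t ord0 i - e i, f t ord0 i[.
    by move=> i; apply: rat_in_itvoo; rewrite ltrBlDr ltrDl; have [] := eP i.
  have /choice[b bP] : forall i, exists q : rat, ratr q \in `]f t ord0 i, f t ord0 i + e i[.
    by move=> i; apply: rat_in_itvoo; rewrite ltrDl; have [] := eP i.
  exists (\row_i a i, \row_i b i) => /=.
    move=> v vb; apply: PU => i j; rewrite ord1; have [_] := eP j; apply.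
    have := vb j; rewrite /= !mxE !in_itv/= => /andP[av vb'].
    have := aP j; have := bP j; rewrite !in_itv/= => /andP[_ b2] /andP[a1 _].
    rewrite /ball/= ltr_distlC.
    by rewrite (lt_trans a1 av) (lt_trans vb' b2).
  move=> i; rewrite /= !mxE in_itv/=.
  by have := aP i; have := bP i; rewrite !in_itv/= => /andP[-> _] /andP[_ ->].
rewrite bigcup_mkcond; apply: countable_bigcupT_measurable; first exact: countableP.
move=> q; case: ifPn => // _.
have -> : f @^-1` box q = \bigcap_(i in [set: 'I_n])
    ((fun t => f t ord0 i) @^-1` [set` `]ratr (q.1 ord0 i), ratr (q.2 ord0 i)[]).
  by apply/seteqP; split => [t ft i _|t ft i]; exact: ft.
apply: fin_bigcap_measurable => // i _.
by rewrite -[X in measurable X]setTI; exact: mf.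
Qed.

End borel_rV.

Section lebesgue_rV.
Context (R : realType).
Local Open Scope ereal_scope.

Definition cons_rV n (p : measurableTypeR R * 'rV[R]_n) : 'rV[R]_n.+1 :=
  \row_i oapp (fun j => p.2 ord0 j) p.1 (unlift ord0 i).

Lemma cons_rV0 n p : @cons_rV n p ord0 ord0 = p.1.
Proof. by rewrite mxE unlift_none. Qed.

Lemma cons_rVS n p i : @cons_rV n p ord0 (lift ord0 i) = p.2 ord0 i.
Proof. by rewrite mxE liftK. Qed.

Lemma measurable_cons_rV n : measurable_fun setT (@cons_rV n).
Proof.
apply: measurable_fun_rV => i; case: (unliftP ord0 i) => [j|] ->.
  under eq_fun do rewrite cons_rVS.
  exact: measurableT_comp (measurable_rV_coord j) measurable_snd.
under eq_fun do rewrite cons_rV0.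
exact: measurable_fst.
Qed.

(* Lebesgue measure on the Borel sets of R^n, as an iterated product; it is the
   measure that gives boxes their volume, see lebesgue_rV_box. *)
Fixpoint lebesgue_rV n : set 'rV[R]_n -> \bar R :=
  match n with
  | 0 => \d_(0%R : 'rV[R]_0)
  | m.+1 => pushforward (lebesgue_measure \x @lebesgue_rV m) (@cons_rV m)
  end.

Lemma lebesgue_rV_sigma_finite_measure n :
  exists m : {measure set 'rV[R]_n -> \bar R},
    sigma_finite setT m /\ @lebesgue_rV n = m :> (set 'rV[R]_n -> \bar R).
Proof.
elim: n => [|n [m0 [sm0 mE]]].
  exists (\d_(0%R : 'rV[R]_0) : {measure set _ -> \bar R}); split => //.
  exact: sigma_finiteT.
rewrite /=.
pose m : {sigma_finite_measure set 'rV[R]_n -> \bar R} :=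
  HB.pack_for (SigmaFiniteMeasure.type 'rV[R]_n R) (Measure.sort m0)
    (isSFinite.Build _ _ _ _ (sfinite_measure_sigma_finite sm0))
    (isSigmaFinite.Build _ _ _ _ sm0).
have {}mE : @lebesgue_rV n = m :> (set 'rV[R]_n -> \bar R) by [].
rewrite mE.
pose l : {sigma_finite_measure set (measurableTypeR R) -> \bar R} :=
  lebesgue_measure.
pose P : {measure set (measurableTypeR R * 'rV[R]_n)%type -> \bar R} := l \x m.
have [F TF Foo] : sigma_finite setT P.
  have /sigma_finiteP[F [TF ndF Foo]] := sigma_finiteT l.
  have /sigma_finiteP[G [TG ndG Goo]] := sigma_finiteT m.
  exists (fun k => F k `*` G k).
    rewrite -setXTT TF TG predeqE => -[x y]; split.
      move=> [/= [i _ Fix] [k _ Gky]]; exists (maxn i k) => //; split.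
      - by move: x Fix; exact/subsetPset/ndF/leq_maxl.
      - by move: y Gky; exact/subsetPset/ndG/leq_maxr.
    by move=> [k _ []/= ? ?]; split; exists k.
  move=> k; have [? ?] := Foo k; have [? ?] := Goo k.
  split; first exact: measurableX.
  have -> : P (F k `*` G k) = l (F k) * m (G k) by exact: product_measure1E.
  by rewrite lte_mul_pinfty// ge0_fin_numE.
exists (measure_function_pushforward__canonical__measure_function_Measure
  P (@measurable_cons_rV n)); split => //.
  pose uncons (v : 'rV[R]_n.+1) : measurableTypeR R * 'rV[R]_n :=
    (v ord0 ord0, \row_j v ord0 (lift ord0 j)).
  have muncons : measurable_fun setT uncons.
    apply/measurable_fun_pairP; split; first exact: measurable_rV_coord.
    apply: measurable_fun_rV => j; rewrite /uncons/=.
    under eq_fun do rewrite mxE.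
    exact: measurable_rV_coord.
  have consK : cancel (@cons_rV n) uncons.
    move=> [x v]; rewrite /uncons cons_rV0; congr pair.
    by apply/rowP => j; rewrite mxE cons_rVS.
  exists (fun k => uncons @^-1` F k).
    by rewrite -preimage_bigcup -TF preimage_setT.
  move=> k; have [mF Fk] := Foo k; split.
    by rewrite -[X in measurable X]setTI; exact: muncons.
  have FE : @cons_rV n @^-1` (uncons @^-1` F k) = F k.
    by apply/seteqP; split => x /=; rewrite consK.
  by move: Fk; rewrite -{1}FE.
Qed.

Let lebesgue_rV0 n : @lebesgue_rV n set0 = 0.
Proof. by have [m [_ ->]] := lebesgue_rV_sigma_finite_measure n. Qed.

Let lebesgue_rV_ge0 n A : 0 <= @lebesgue_rV n A.
Proof. by have [m [_ ->]] := lebesgue_rV_sigma_finite_measure n. Qed.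

Let lebesgue_rV_semi_sigma_additive n : semi_sigma_additive (@lebesgue_rV n).
Proof.
have [m [_ ->]] := lebesgue_rV_sigma_finite_measure n.
exact: measure_semi_sigma_additive.
Qed.

HB.instance Definition _ n := isMeasure.Build _ _ _ (@lebesgue_rV n)
  (lebesgue_rV0 n) (@lebesgue_rV_ge0 n) (@lebesgue_rV_semi_sigma_additive n).

Let lebesgue_rV_sigma_finite n : sigma_finite setT (@lebesgue_rV n).
Proof.
by have [m [sm ->]] := lebesgue_rV_sigma_finite_measure n.
Qed.

HB.instance Definition _ n := Measure_isSigmaFinite.Build _ _ _ (@lebesgue_rV n)
  (lebesgue_rV_sigma_finite n).

Lemma lebesgue_rV_box n (a b : 'rV[R]_n) : (forall i, a ord0 i <= b ord0 i)%R ->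
  lebesgue_rV [set v | forall i, (a ord0 i <= v ord0 i <= b ord0 i)%R] =
  (\prod_(i < n) (b ord0 i - a ord0 i))%:E.
Proof.
elim: n a b => [|n IHn] a b ab.
  rewrite big_ord0 /= diracE mem_set//=.
  by case.
rewrite big_ord_recl /=.
pose tl (v : 'rV[R]_n.+1) : 'rV[R]_n := \row_j v ord0 (lift ord0 j).
pose B := [set v : 'rV[R]_n | forall i, (tl a ord0 i <= v ord0 i <= tl b ord0 i)%R].
have mB : measurable B.
  rewrite (_ : B = \bigcap_(i in [set: 'I_n])
      ((fun v => v ord0 i) @^-1` `[tl a ord0 i, tl b ord0 i])); last first.
    apply/seteqP; split => [v vB i _|v vB i].
      by rewrite /= in_itv/=; exact: vB.
    by have := vB i I; rewrite /= in_itv/=.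
  apply: fin_bigcap_measurable => // i _.
  by rewrite -[X in measurable X]setTI; exact: measurable_rV_coord.
rewrite /pushforward (_ : _ @^-1` _ = `[a ord0 ord0, b ord0 ord0] `*` B); last first.
  apply/seteqP; split => [[x v] /= xv|[x v] /= [xab vB] i].
    split; first by have := xv ord0; rewrite cons_rV0 in_itv.
    by move=> i; have := xv (lift ord0 i); rewrite cons_rVS !mxE.
  case: (unliftP ord0 i) => [j|] ->; last by rewrite cons_rV0; rewrite in_itv in xab.
  by rewrite cons_rVS/=; have := vB j; rewrite !mxE.
rewrite product_measure1E//= IHn; last by move=> i; rewrite !mxE; exact: ab.
rewrite lebesgue_measure_itv/= lte_fin.
under eq_bigr do rewrite !mxE.
case: ltP => [_|ba]; first by rewrite EFinM.
have -> : a ord0 ord0 = b ord0 ord0 by apply/eqP; rewrite eq_le ab ba.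
by rewrite mul0e subrr mul0r.
Qed.

End lebesgue_rV.
Arguments lebesgue_rV {R n}.

(* A function on an open set Omega of R^n is represented by a function on the
   whole of R^n whose values outside Omega are irrelevant.  Elements of
   L^2(Omega) are represented by functions, up to equality a.e. on Omega; since
   point = 0 in R, f \_ Omega is the extension of f by 0. *)
Section L2.
Context (R : realType) (n : nat).
Notation E := 'rV[R]_n.
Notation mu := (@lebesgue_rV R n).
Implicit Types (Omega : set E) (f g : E -> R) (phi psi e : nat -> E -> R).

Definition L2 Omega f : Prop := f \_ Omega \in Lfun mu 2%:E.

Definition norm_L2 Omega f : \bar R := 'N[mu]_(2%:E)[EFin \o (f \_ Omega)].

Definition inner_L2 Omega f g : R := \int[mu]_(x in Omega) (f x * g x).

(* f = \sum_k c_k phi_k, with convergence of the series in L^2(Omega). *)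
Definition series_L2 Omega (c : nat -> R) phi f : Prop :=
  norm_L2 Omega (fun x => f x - \sum_(k < N) c k * phi k x) @[N --> \oo]
    --> 0%E.

Definition orthonormal_basis Omega e : Prop :=
  [/\ forall k, L2 Omega (e k),
      forall k m, inner_L2 Omega (e k) (e m) = (k == m)%:R
    & forall f, L2 Omega f ->
        series_L2 Omega (fun k => inner_L2 Omega f (e k)) e f].

(* A bounded linear operator L^2(Omega') -> L^2(Omega), acting on
   representatives; operator_ae makes it well defined on classes. *)
Record bounded_operator Omega' Omega (U : (E -> R) -> E -> R) : Prop := {
  operator_L2 : forall f, L2 Omega' f -> L2 Omega (U f) ;
  operator_ae : forall f g, L2 Omega' f -> L2 Omega' g ->
    f = g %[ae mu in Omega'] -> U f = U g %[ae mu in Omega] ;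
  operator_linear : forall (a : R) f g, L2 Omega' f -> L2 Omega' g ->
    U (a \*: f \+ g) = a \*: U f \+ U g %[ae mu in Omega] ;
  operator_bounded : exists C : R, forall f, L2 Omega' f ->
    (norm_L2 Omega (U f) <= C%:E * norm_L2 Omega' f)%E }.

Definition bijective_operator Omega' Omega (U : (E -> R) -> E -> R) : Prop :=
  (forall f g, L2 Omega' f -> L2 Omega' g ->
     U f = U g %[ae mu in Omega] -> f = g %[ae mu in Omega']) /\
  (forall g, L2 Omega g ->
     exists2 f, L2 Omega' f & U f = g %[ae mu in Omega]).

Definition riesz_basis Omega phi : Prop :=
  (forall k, L2 Omega (phi k)) /\
  exists (Omega' : set E) (e : nat -> E -> R) (U : (E -> R) -> E -> R),
    [/\ open Omega', orthonormal_basis Omega' e,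
        bounded_operator Omega' Omega U, bijective_operator Omega' Omega U
      & forall k, phi k = U (e k) %[ae mu in Omega]].

Definition biorthogonal_dual Omega phi psi : Prop :=
  [/\ riesz_basis Omega psi,
      forall k m, inner_L2 Omega (psi k) (phi m) = (k == m)%:R
    & forall f, L2 Omega f ->
        series_L2 Omega (fun k => inner_L2 Omega f (psi k)) phi f].

Definition measurable_map (Omega Omega' : set E) (h : E -> E) : Prop :=
  measurable_fun Omega h /\ forall x, Omega x -> Omega' (h x).

Definition nonsingular (Omega Omega' : set E) (h : E -> E) : Prop :=
  forall B, measurable B -> B `<=` Omega' ->
    mu B = 0%E -> mu (Omega `&` h @^-1` B) = 0%E.

Definition composition_operator (h : E -> E) f : E -> R := f \o h.

Definition multiplication_operator (k f : E -> R) : E -> R := k \* f.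

Definition ae_inverse (Omega1 Omega2 : set E) (h hinv : E -> E) : Prop :=
  {ae mu, forall x, Omega2 x -> hinv (h x) = x} /\
  {ae mu, forall y, Omega1 y -> h (hinv y) = y}.

Definition pushforward_on Omega (h : E -> E) : set E -> \bar R :=
  fun B => mu (Omega `&` h @^-1` B).

Definition radon_nikodym_derivative Omega (nu : set E -> \bar R) g : Prop :=
  [/\ measurable_fun Omega g,
      {ae mu, forall x, Omega x -> 0 <= g x}
    & forall B, measurable B -> B `<=` Omega ->
        nu B = (\int[mu]_(x in B) (g x)%:E)%E].

End L2.

(* Main.v *)
Require Import Defs.
From HB Require Import structures.
From mathcomp Require Import all_boot all_order all_algebra.
From mathcomp Require Import all_classical all_reals all_analysis.
From mathcomp Require Import measurable_realfun ring lra.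
Set Implicit Arguments.
Unset Strict Implicit.
Unset Printing Implicit Defensive.
Import Order.TTheory GRing.Theory Num.Theory.
Import numFieldNormedType.Exports.
Local Open Scope classical_set_scope.
Local Open Scope ring_scope.

(** Write C f = f \o h and T f = g * (f \o h).  Since hinv pushes Lebesgue
    measure on Omega1 to the measure with density g on Omega2, the change of
    variables formula (ge0_change_of_variables, Rintegral_change_of_variables)
    says that the integral over Omega1 of v \o hinv is the integral over Omega2
    of v * g.  Applied to v = F * (f \o h) it reads
      <F, T f> on Omega2 = <F \o hinv, f> on Omega1      (inner_L2_weighted),
    so T is the adjoint of the inverse of C.  Biorthogonality of C gamma_k and
    T gammad_k is this identity with F = gamma_m \o h, and the expansion of F
    along C gamma_k is the image under C of the expansion of F \o hinv along
    gamma_k.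

    What remains is analytic: C and its inverse must be bounded in L^2, so that
    the second expansion converges and T is a bounded bijection, which makes
    (T gammad_k) a Riesz basis.  Both bounds come from riesz_comp_bound, applied
    once to h with the basis gamma and once to hinv with the basis C gamma_k: if
    (b_k) is a Riesz basis of L^2(Omega) and phi : Omega' -> Omega is
    non-singular with ||sum c_k (b_k \o phi)||^2 <= K sum c_k^2, then
    composition with phi is bounded.
    The proof does not use the open mapping theorem.  Given F in L^2(Omega),
    surjectivity of the operator defining the basis yields an expansion
    F = sum c_k b_k with square summable coefficients.  A subsequence of the
    partial sums converges a.e., non-singularity carries this to Omega', and
    Fatou's lemma gives F \o phi in L^2(Omega') (riesz_comp_finite).  So
    composition with phi maps integrable nonnegative functions to integrable
    ones, and a condensation argument upgrades finiteness to a uniform bound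
    (comp_integral_bound).

    A Radon-Nikodym derivative is nonnegative only almost everywhere; the
    argument is run with max(g, 0) and transported to g by
    biorthogonal_dual_ae. *)

(** * Square norms on L^2 *)

Section L2_basics.
Context (R : realType) (n : nat).
Notation E := 'rV[R]_n.
Notation mu := (@lebesgue_rV R n).
Implicit Types (Omega : set E) (f g : E -> R).

Definition sqnorm Omega f : \bar R := (\int[mu]_(x in Omega) (f x ^+ 2)%:E)%E.

Lemma sqnorm_ge0 Omega f : (0 <= sqnorm Omega f)%E.
Proof. by apply: integral_ge0 => x _; rewrite lee_fin sqr_ge0. Qed.

Lemma integral_restrict_sqr Omega f :
  (\int[mu]_x (`| ((f \_ Omega) x)%:E | `^ 2) = sqnorm Omega f)%E.
Proof.
rewrite /sqnorm [RHS]integral_mkcond. apply: eq_integral => x _.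
rewrite !patchE; case: ifPn => _ /=.
  by rewrite powR_mulrn// real_normK// num_real.
by rewrite normr0 powR0.
Qed.

Lemma norm_L2_sqr Omega f : (norm_L2 Omega f `^ 2 = sqnorm Omega f)%E.
Proof. by rewrite /norm_L2 poweR_Lnorm// integral_restrict_sqr. Qed.

Lemma norm_L2E Omega f : (norm_L2 Omega f = sqnorm Omega f `^ 2^-1)%E.
Proof. by rewrite -integral_restrict_sqr /norm_L2 unlock. Qed.

Lemma norm_L2_ge0 Omega f : (0 <= norm_L2 Omega f)%E.
Proof. by rewrite norm_L2E poweR_ge0. Qed.

Lemma L2P Omega f : measurable Omega ->
  L2 Omega f <-> measurable_fun Omega f /\ (sqnorm Omega f < +oo)%E.
Proof.
move=> mO; rewrite /L2 inE; split.
  move=> /andP[/[!inE]/= mf fin]; split; first exact/(measurable_restrictT _ _).2.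
  by rewrite -norm_L2_sqr poweR_lty.
move=> [mf fin]; apply/andP; rewrite !inE/=; split.
  exact/(measurable_restrictT _ _).1.
by rewrite /finite_norm -/(norm_L2 Omega f) norm_L2E poweR_lty.
Qed.

(** The bridge between the norm, whose square root is awkward to compute with,
    and the integrals on which all estimates below are made. *)
Lemma norm_L2_le Omega Omega' f g (C : R) : 0 <= C ->
  (norm_L2 Omega f <= C%:E * norm_L2 Omega' g)%E <->
  (sqnorm Omega f <= (C ^+ 2)%:E * sqnorm Omega' g)%E.
Proof.
move=> C0; split=> [h|h].
  rewrite -!norm_L2_sqr -(@powR_mulrn _ C)// -[(_ `^ _)%:E]/((C%:E `^ 2)%E).
  rewrite -poweRM// ?norm_L2_ge0//.
  apply: gt0_ler_poweR => //; rewrite in_itv/= leey andbT ?norm_L2_ge0//.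
  by rewrite mule_ge0// norm_L2_ge0.
rewrite !norm_L2E; have -> : (C%:E = (C ^+ 2)%:E `^ 2^-1)%E.
  by rewrite poweR_EFin powR12_sqrt ?sqr_ge0// sqrtr_sqr ger0_norm.
rewrite -poweRM ?lee_fin ?sqr_ge0 ?sqnorm_ge0//.
apply: gt0_ler_poweR => //; rewrite in_itv/= leey andbT ?sqnorm_ge0//.
by rewrite mule_ge0 ?lee_fin ?sqr_ge0 ?sqnorm_ge0.
Qed.

Lemma eq_ae_sqnorm Omega f g : measurable Omega ->
  measurable_fun Omega f -> measurable_fun Omega g ->
  f = g %[ae mu in Omega] -> sqnorm Omega f = sqnorm Omega g.
Proof.
move=> mO mf mg fg; apply: ge0_ae_eq_integral => //.
- by apply/measurable_EFinP; exact: measurable_funX.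
- by apply/measurable_EFinP; exact: measurable_funX.
- by move=> x _; rewrite lee_fin sqr_ge0.
- by move=> x _; rewrite lee_fin sqr_ge0.
- by move: fg; apply: filterS => x /[apply] ->.
Qed.

End L2_basics.

(** * Finite sums, Bessel bounds and Riesz bases *)

Section inner_product.
Context (R : realType) (n : nat).
Notation E := 'rV[R]_n.
Notation mu := (@lebesgue_rV R n).
Variable Omega : set E.
Hypothesis mO : measurable Omega.
Implicit Types (f g : E -> R).

Lemma L2_measurable f : L2 Omega f -> measurable_fun Omega f.
Proof. by move=> /(L2P _ mO)[]. Qed.

Lemma L2_sqnorm_fin_num f : L2 Omega f -> sqnorm Omega f \is a fin_num.
Proof. by move=> /(L2P _ mO)[_ ?]; rewrite ge0_fin_numE// sqnorm_ge0. Qed.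

Lemma L2_mul_integrable f g : L2 Omega f -> L2 Omega g ->
  mu.-integrable Omega (fun x => (f x * g x)%:E).
Proof.
move=> Lf Lg; have /Lfun1_integrable := Lfun2_mul_Lfun1 Lf Lg.
move=> fg; apply/(integrable_mkcond _ mO).
rewrite [X in _.-integrable _ X](_ : _ = EFin \o (f \_ Omega \* g \_ Omega))//.
by apply/funext => x /=; rewrite !patchE; case: ifPn => // _; rewrite mul0r.
Qed.

Lemma inner_L2_self f : L2 Omega f -> (inner_L2 Omega f f)%:E = sqnorm Omega f.
Proof.
move=> Lf; rewrite /inner_L2 /Rintegral fineK.
  by apply: eq_integral => x _; rewrite expr2.
exact/integrable_fin_num/L2_mul_integrable.
Qed.

Lemma inner_L2C f g : inner_L2 Omega f g = inner_L2 Omega g f.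
Proof. by apply: eq_Rintegral => x _; rewrite mulrC. Qed.

Lemma L2_lincomb (a : R) f g : L2 Omega f -> L2 Omega g ->
  L2 Omega (fun x => a * f x + g x).
Proof.
move=> Lf Lg; rewrite /L2.
have -> : (fun x => a * f x + g x) \_ Omega = a *: (f \_ Omega) + g \_ Omega.
  apply/funext => x; rewrite /= /GRing.add/= /GRing.scale/= !patchE.
  by case: ifPn => //; rewrite scaler0 addr0.
exact: (@Lfun_submod_closed _ _ _ mu _ (lee1n 2)).2.
Qed.

Lemma inner_L2_lincombl (a : R) f g w : L2 Omega f -> L2 Omega g -> L2 Omega w ->
  inner_L2 Omega (fun x => a * f x + g x) w =
  a * inner_L2 Omega f w + inner_L2 Omega g w.
Proof.
move=> Lf Lg Lw; rewrite /inner_L2 -RintegralZl//; last exact: L2_mul_integrable.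
rewrite -RintegralD//.
- by apply: eq_Rintegral => x _; rewrite mulrDl mulrA.
- have := integrableZl mO a (L2_mul_integrable Lf Lw).
  by apply: eq_integrable => // x _; rewrite EFinM.
- exact: L2_mul_integrable.
Qed.

Lemma inner_L2_ge0 f : 0 <= inner_L2 Omega f f.
Proof. by apply: Rintegral_ge0 => x _; rewrite -expr2 sqr_ge0. Qed.

Lemma L2_cst0 : L2 Omega (fun=> 0).
Proof.
apply/(L2P _ mO); split; first exact: measurable_cst.
by rewrite /sqnorm integral0_eq// => x _; rewrite expr0n.
Qed.

Definition partial_sum (c : nat -> R) (phi : nat -> E -> R) (N : nat) : E -> R :=
  fun x => \sum_(k < N) c k * phi k x.

Lemma partial_sum0 c phi : partial_sum c phi 0 = fun=> 0.
Proof. by apply/funext => x; rewrite /partial_sum big_ord0. Qed.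

Lemma partial_sumS c phi N :
  partial_sum c phi N.+1 = fun x => c N * phi N x + partial_sum c phi N x.
Proof. by apply/funext => x; rewrite /partial_sum big_ord_recr/= addrC. Qed.

Section partial_sum.
Variables (c : nat -> R) (phi : nat -> E -> R).
Hypothesis Lphi : forall k, L2 Omega (phi k).

Lemma L2_partial_sum N : L2 Omega (partial_sum c phi N).
Proof.
elim: N => [|N IH]; first by rewrite partial_sum0; exact: L2_cst0.
by rewrite partial_sumS; exact: L2_lincomb.
Qed.

Lemma inner_L2_partial_suml f N : L2 Omega f ->
  inner_L2 Omega (partial_sum c phi N) f =
  \sum_(k < N) c k * inner_L2 Omega (phi k) f.
Proof.
move=> Lf; elim: N => [|N IH].
  rewrite partial_sum0 big_ord0 /inner_L2 /Rintegral integral0_eq// => x _.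
  by rewrite mul0r.
rewrite partial_sumS inner_L2_lincombl//; last exact: L2_partial_sum.
by rewrite IH big_ord_recr/= addrC.
Qed.

Lemma sqnorm_orthonormal N :
  (forall k m, inner_L2 Omega (phi k) (phi m) = (k == m)%:R) ->
  sqnorm Omega (partial_sum c phi N) = (\sum_(k < N) c k ^+ 2)%:E.
Proof.
move=> on; rewrite -inner_L2_self; last exact: L2_partial_sum.
rewrite inner_L2_partial_suml; last exact: L2_partial_sum.
congr (_%:E); apply: eq_bigr => k _; rewrite inner_L2C inner_L2_partial_suml//.
rewrite (bigD1 k)//= on eqxx mulr1 big1 ?addr0 ?expr2// => i ik.
by rewrite on [(_ == _)%N](negbTE ik) mulr0.
Qed.

End partial_sum.

(** The synthesis operator c |-> sum c_k phi_k is bounded from l^2 to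
    L^2(Omega); positivity of C lets one divide by it. *)
Definition bessel_bounded (phi : nat -> E -> R) (C : R) : Prop :=
  0 < C /\ forall (c : nat -> R) N,
    (sqnorm Omega (partial_sum c phi N) <= (C * \sum_(k < N) c k ^+ 2)%:E)%E.

(** Boundedness of the adjoint of the synthesis operator.  With
    d_k = <f, phi_k> and w = sum d_k phi_k one has <w, f> = sum d_k^2 and
    ||w||^2 <= C <w, f>, so expanding 0 <= ||w - C f||^2 is enough. *)
Lemma bessel_inequality phi C f N :
  (forall k, L2 Omega (phi k)) -> bessel_bounded phi C ->
  L2 Omega f ->
  ((\sum_(k < N) inner_L2 Omega f (phi k) ^+ 2)%:E <= C%:E * sqnorm Omega f)%E.
Proof.
move=> Lphi [C0 up] Lf.
pose d k := inner_L2 Omega f (phi k).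
pose w := partial_sum d phi N.
have Lw : L2 Omega w by exact: L2_partial_sum.
have := up d N; rewrite -/w -inner_L2_self// lee_fin -/d.
rewrite -inner_L2_self// -EFinM lee_fin.
have wf : inner_L2 Omega w f = \sum_(k < N) d k ^+ 2.
  rewrite inner_L2_partial_suml//; apply: eq_bigr => k _.
  by rewrite inner_L2C expr2.
rewrite -wf; set s := inner_L2 Omega w f => sw.
have := inner_L2_ge0 (fun x => (- C) * f x + w x).
have Lu := L2_lincomb (- C) Lf Lw.
set u := (fun x => _) in Lu *.
have uE v : L2 Omega v ->
    inner_L2 Omega u v = - C * inner_L2 Omega f v + inner_L2 Omega w v.
  by move=> Lv; rewrite inner_L2_lincombl.
rewrite uE// (inner_L2C f u) (inner_L2C w u) !uE// (inner_L2C f w) -/s.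
set F := inner_L2 _ f f; set W := inner_L2 _ w w => h.
rewrite -/W in sw.
have : C * s <= C * (C * F) by nra.
by rewrite ler_pM2l.
Qed.

End inner_product.

Section riesz.
Context (R : realType) (n : nat).
Notation E := 'rV[R]_n.
Notation mu := (@lebesgue_rV R n).

(** U is linear only up to null sets, which is harmless for finite sums. *)
Lemma operator_partial_sum (Omega' Omega : set E) U (c : nat -> R) e N :
  measurable Omega' -> bounded_operator Omega' Omega U ->
  (forall k, L2 Omega' (e k)) ->
  U (partial_sum c e N) =
    partial_sum c (fun k => U (e k)) N %[ae mu in Omega].
Proof.
move=> mO' bU Le; elim: N => [|N IH].
  rewrite !partial_sum0.
  have L0 := L2_cst0 mO'.
  have := operator_linear bU (-1) L0 L0.
  apply: filterS => x /[apply] /=.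
  have -> : -1 \*: (fun=> 0 : R) \+ (fun=> 0) = (fun=> 0) :> (E -> R).
    by apply/funext => y /=; rewrite scaler0 addr0.
  by move=> ->; rewrite /= scaleN1r addNr.
rewrite !partial_sumS.
have := operator_linear bU (c N) (Le N) (L2_partial_sum mO' c Le N).
move: IH; apply: filterS2 => x /= h1 h2 Ox.
by rewrite -(h1 Ox); exact: h2.
Qed.

Lemma bounded_operator_sqnorm (Omega' Omega : set E) U :
  bounded_operator Omega' Omega U -> exists2 C : R, 0 < C &
    forall f, L2 Omega' f -> (sqnorm Omega (U f) <= C%:E * sqnorm Omega' f)%E.
Proof.
move=> bU; have [C CP] := operator_bounded bU.
exists ((`|C| + 1) ^+ 2) => [|f Lf]; first by rewrite exprn_gt0// ltr_wpDl.
apply/norm_L2_le; first by rewrite addr_ge0.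
apply: (le_trans (CP f Lf)); rewrite lee_wpmul2r ?norm_L2_ge0// lee_fin.
by rewrite (le_trans (ler_norm _))// lerDl.
Qed.

(** U maps sum c_k e_k, of square norm sum c_k^2, to sum c_k phi_k. *)
Lemma riesz_basis_bessel_bounded (Omega : set E) phi : measurable Omega ->
  riesz_basis Omega phi -> exists C, bessel_bounded Omega phi C.
Proof.
move=> mO [Lphi [ Omega' [e [U [oO' [Le orthoe _] bU _ phiE]]]]].
have mO' : measurable Omega' by exact: sub_sigma_algebra.
have [C C0 CU] := bounded_operator_sqnorm bU.
exists C; split => // c N.
rewrite (@eq_ae_sqnorm _ _ _ _ (U (partial_sum c e N)))//.
- by rewrite EFinM -(sqnorm_orthonormal mO' c Le)//; exact/CU/L2_partial_sum.
- by apply: L2_measurable => //; exact: L2_partial_sum.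
- by apply: L2_measurable => //; apply: (operator_L2 bU); exact: L2_partial_sum.
have := operator_partial_sum c N mO' bU Le.
have /ae_foralln := phiE; apply: filterS2 => x h1 /[swap] Ox ->//.
by apply: eq_bigr => k _; rewrite h1.
Qed.

End riesz.

(** * Non-singular maps and almost everywhere limits *)

Section ae_limits.
Context (R : realType) (n : nat).
Notation E := 'rV[R]_n.
Notation mu := (@lebesgue_rV R n).
Implicit Types (Omega : set E) (phi : E -> E).

Lemma measurable_map_comp d (T : measurableType d) Omega' Omega phi (f : E -> T) :
  measurable Omega -> measurable_map Omega' Omega phi ->
  measurable_fun Omega f -> measurable_fun Omega' (f \o phi).
Proof.
move=> mO [mphi sub] mf; apply: (measurable_comp mO) => //.
by move=> _ [x Ox <-]; exact: sub.
Qed.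

(** The form in which non-singularity is used: a.e. properties can be pulled
    back. *)
Lemma nonsingular_ae Omega' Omega phi (P : E -> Prop) :
  measurable Omega -> measurable Omega' -> measurable_map Omega' Omega phi ->
  nonsingular Omega' Omega phi ->
  {ae mu, forall x, Omega x -> P x} ->
  {ae mu, forall y, Omega' y -> P (phi y)}.
Proof.
move=> mO mO' [mphi sub] ns [N [mN N0 NP]].
have mB : measurable (N `&` Omega) by exact: measurableI.
exists (Omega' `&` phi @^-1` (N `&` Omega)); split.
- exact: mphi.
- apply: ns; [exact: mB|by move=> x []|].
  by apply: (subset_measure0 _ _ _ N0) => // x [].
move=> y /= /not_implyP[Oy nP]; split => //; split; last exact: sub.
by apply: NP => /= h; apply: nP; apply: h; exact: sub.
Qed.

Lemma sqnorm_le_of_norm_L2 Omega (f : E -> R) (e : R) : 0 <= e ->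
  (norm_L2 Omega f <= e%:E)%E -> (sqnorm Omega f <= (e ^+ 2)%:E)%E.
Proof.
move=> e0 h; rewrite -norm_L2_sqr -(@powR_mulrn _ e)// -poweR_EFin.
apply: gt0_ler_poweR => //; rewrite in_itv/= leey andbT ?norm_L2_ge0//.
Qed.

(** The sum of the u_j^2 has a finite integral, hence is finite a.e., and the
    terms of a convergent series tend to 0. *)
Lemma summable_sqnorm_ae_cvg0 Omega (u : nat -> E -> R) : measurable Omega ->
  (forall j, measurable_fun Omega (u j)) ->
  (forall j, sqnorm Omega (u j) <= (1 / (2 ^ j.+1)%:R)%:E)%E ->
  {ae mu, forall x, Omega x -> u j x @[j --> \oo] --> 0}.
Proof.
move=> mO mu_ su.
have mu2 j : measurable_fun Omega (fun x => (u j x ^+ 2)%:E).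
  by apply/measurable_EFinP; exact: measurable_funX.
have u20 j x : (0 <= (u j x ^+ 2)%:E :> \bar R)%E by rewrite lee_fin sqr_ge0.
pose S x : \bar R := (\sum_(j <oo) (u j x ^+ 2)%:E)%E.
have S0 x : (0 <= S x)%E by exact: nneseries_ge0.
have mS : measurable_fun Omega S.
  by apply: (@ge0_emeasurable_sum _ _ _ _ _ xpredT) => // k x _ _; exact: u20.
have iS : mu.-integrable Omega S.
  apply/integrableP; split => //.
  under eq_integral do rewrite gee0_abs//.
  rewrite integral_nneseries//; apply: (@le_lt_trans _ _ 1%:E); last exact: ltry.
  apply: le_trans (epsilon_trick0 xpredT (@ler01 R)).
  by apply: lee_nneseries => j *; [exact: sqnorm_ge0|exact: su].
have := integrable_ae mO iS; apply: filterS => x /[apply] Sx.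
have /cvg_series_cvg_0 cv : cvgn (series (fun j => u j x ^+ 2)).
  apply: nnseries_is_cvg => [j|]; first exact: sqr_ge0.
  by rewrite -ge0_fin_numE//; exact: S0.
apply/cvgr0Pnorm_lt => e e0.
have := cv; move=> /cvgr0Pnorm_lt /(_ (e ^+ 2)) /(_ (exprn_gt0 _ e0)).
apply: filterS => j; rewrite normrX.
by rewrite ltr_pXn2r// nnegrE ?ltW.
Qed.

Lemma norm_L2_cvg0_ae Omega (u : nat -> E -> R) : measurable Omega ->
  (forall N, measurable_fun Omega (u N)) ->
  norm_L2 Omega (u N) @[N --> \oo] --> 0%E ->
  exists s : nat -> nat,
    {ae mu, forall x, Omega x -> u (s j) x @[j --> \oo] --> 0}.
Proof.
move=> mO mu_ /fine_cvgP[fin cv].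
have /choice[s sP] : forall j, exists N,
    (sqnorm Omega (u N) <= (1 / (2 ^ j.+1)%:R)%:E)%E.
  move=> j; pose e : R := Num.sqrt (1 / (2 ^ j.+1)%:R).
  have e0 : 0 < e by rewrite sqrtr_gt0 divr_gt0// ltr0n expn_gt0.
  have /cvgr0Pnorm_lt /(_ e e0) near_e := cv.
  have [N _ /(_ N (leqnn N)) [finN Ne]] := filterI fin near_e.
  exists N; have -> : 1 / (2 ^ j.+1)%:R = e ^+ 2 by rewrite sqr_sqrtr.
  apply: sqnorm_le_of_norm_L2; first exact: ltW.
  by rewrite -(fineK finN) lee_fin (le_trans (ler_norm _))// ltW.
exists s; apply: summable_sqnorm_ae_cvg0 => //.
Qed.

Lemma measurable_fun_limn_einf d (T : measurableType d) (D : set T)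
    (F : nat -> T -> \bar R) :
  (forall j, measurable_fun D (F j)) ->
  measurable_fun D (fun x => limn_einf (F ^~ x)).
Proof.
move=> mF.
rewrite (_ : (fun _ => _) = (fun x => - limn_esup (fun j => - F j x))%E).
  apply: measurableT_comp => //; apply: measurable_fun_limn_esup => j.
  exact: measurableT_comp.
apply/funext => x; rewrite -limn_einfN; congr limn_einf.
by apply/funext => j /=; rewrite oppeK.
Qed.

(** Convergence in L^2(Omega) says nothing directly about S_N \o phi, since
    composition with phi is not yet known to be bounded; a.e. convergence of a
    subsequence does survive composition, and Fatou's lemma passes the bound C
    to the limit. *)
Lemma sqnorm_comp_le Omega' Omega phi (S : nat -> E -> R) (f : E -> R)
    (C : \bar R) :
  measurable Omega -> measurable Omega' -> measurable_map Omega' Omega phi ->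
  nonsingular Omega' Omega phi ->
  (forall N, measurable_fun Omega (S N)) -> measurable_fun Omega f ->
  norm_L2 Omega (fun x => f x - S N x) @[N --> \oo] --> 0%E ->
  (forall N, (sqnorm Omega' (S N \o phi) <= C)%E) ->
  (sqnorm Omega' (f \o phi) <= C)%E.
Proof.
move=> mO mO' mmap ns mS mf cv SC.
have mcomp (g : E -> R) : measurable_fun Omega g ->
    measurable_fun Omega' (fun y => ((g \o phi) y ^+ 2)%:E).
  move=> mg; apply/measurable_EFinP; apply: measurable_funX.
  exact: (measurable_map_comp mO mmap).
have [|s sP] := norm_L2_cvg0_ae mO _ cv.
  by move=> N; exact: measurable_funB.
pose F j y := (((S (s j) \o phi) y) ^+ 2)%:E : \bar R.
have F0 j y : Omega' y -> (0 <= F j y)%E by rewrite lee_fin sqr_ge0.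
have mF j : measurable_fun Omega' (F j) by exact: mcomp.
have FC : (limn_einf (fun j => \int[mu]_(y in Omega') F j y) <= C)%E.
  rewrite limn_einf_lim; apply: lime_le; first exact: is_cvg_einfs.
  apply: nearW => j; apply: le_trans (SC (s j)).
  by apply: ereal_inf_lbound; exists j => /=.
apply: le_trans FC; apply: le_trans (fatou mu mO' mF F0).
apply: ae_ge0_le_integral => //.
- by move=> y _; rewrite lee_fin sqr_ge0.
- exact: mcomp.
- by move=> y Oy; rewrite limn_einf_lim; apply: lime_ge;
    [exact: is_cvg_einfs|apply: nearW => j; apply: le_ereal_inf_tmp => _ [k _ <-];
     exact: F0].
- exact: measurable_fun_limn_einf.
have := nonsingular_ae mO mO' mmap ns sP.
apply: filterS => y /[apply] cvy.
have : F j y @[j --> \oo] --> (f (phi y) ^+ 2)%:E.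
  apply/fine_cvgP; split; first exact: nearW.
  rewrite /F /comp/=.
  have : S (s j) (phi y) @[j --> \oo] --> f (phi y).
    rewrite -[f (phi y)]subr0; under eq_fun do rewrite -[S _ _](subKr (f (phi y))).
    exact: cvgB (@cvg_cst _ _ _ _ _) cvy.
  by move=> h; rewrite expr2; under eq_fun do rewrite expr2; exact: cvgM.
by move=> /cvg_limn_einf_sup[-> _].
Qed.

End ae_limits.

(** * Uniform bounds for composition with a non-singular map *)

Section uniform_bound.
Context (R : realType) (n : nat).
Notation E := 'rV[R]_n.
Notation mu := (@lebesgue_rV R n).
Implicit Types (Omega : set E) (phi : E -> E).
Local Open Scope ereal_scope.

(** If no M worked, there would be v_j of integral 2^-(j+1) whose compositions
    with phi have integral at least j; their sum is integrable while its
    composition with phi is not.  Non-singularity is what prevents a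
    counterexample v_j from vanishing a.e. on Omega, so that it can be
    normalized. *)
Lemma comp_integral_bound Omega' Omega phi :
  measurable Omega -> measurable Omega' -> measurable_map Omega' Omega phi ->
  nonsingular Omega' Omega phi ->
  (forall v : E -> R, measurable_fun Omega v -> (forall x, 0 <= v x)%R ->
     \int[mu]_(x in Omega) (v x)%:E < +oo ->
     \int[mu]_(y in Omega') (v (phi y))%:E < +oo) ->
  exists2 M : R, (0 < M)%R &
    forall v : E -> R, measurable_fun Omega v -> (forall x, 0 <= v x)%R ->
      \int[mu]_(y in Omega') (v (phi y))%:E <=
        M%:E * \int[mu]_(x in Omega) (v x)%:E.
Proof.
move=> mO mO' mmap ns fin; apply: contrapT => unbounded.
have /choice[v vP] : forall j : nat, exists v : E -> R,
    [/\ measurable_fun Omega v, (forall x, 0 <= v x)%R,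
      \int[mu]_(x in Omega) (v x)%:E = (1 / (2 ^ j.+1)%:R)%:E
    & (j%:R)%:E <= \int[mu]_(y in Omega') (v (phi y))%:E].
  (* This M leaves integral at least j.+1 once v has integral 2^-(j+1). *)
  move=> j; pose M : R := ((2 ^ j.+1)%:R * j.+1%:R)%R.
  have M0 : (0 < M)%R by rewrite mulr_gt0// ltr0n ?expn_gt0.
  have [v [mv v0 vM]] : exists v : E -> R,
      [/\ measurable_fun Omega v, (forall x, 0 <= v x)%R &
        M%:E * \int[mu]_(x in Omega) (v x)%:E <
        \int[mu]_(y in Omega') (v (phi y))%:E].
    apply: contrapT => h; apply: unbounded; exists M => // v mv v0.
    by rewrite leNgt; apply/negP => lt; apply: h; exists v.
  have mv' : measurable_fun Omega (EFin \o v) by exact/measurable_EFinP.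
  have mvphi : measurable_fun Omega' (EFin \o (v \o phi)).
    by apply/measurable_EFinP; exact: measurable_map_comp mmap _.
  have I0 : 0 <= \int[mu]_(x in Omega) (v x)%:E.
    by apply: integral_ge0 => x _; rewrite lee_fin.
  have Ifin : \int[mu]_(x in Omega) (v x)%:E \is a fin_num.
    rewrite ge0_fin_numE// ltey; apply/eqP => Ioo; move: vM.
    by rewrite Ioo gt0_muley ?lte_fin// ltNge leey.
  pose a := fine (\int[mu]_(x in Omega) (v x)%:E).
  have a0 : (0 < a)%R.
    rewrite lt_neqAle fine_ge0// andbT; apply/eqP => a0.
    have : \int[mu]_(x in Omega) `|(v x)%:E| = 0.
      under eq_integral do rewrite gee0_abs ?lee_fin//.
      by rewrite -(fineK Ifin) -/a -a0.
    move=> /(ae_eq_integral_abs mu mO mv')/(nonsingular_ae mO mO' mmap ns) h.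
    move: vM; rewrite -(fineK Ifin) -/a -a0 mule0.
    rewrite (@ge0_ae_eq_integral _ _ _ mu Omega' _ (cst 0)) ?integral0 ?ltxx//.
    by move=> y _; rewrite lee_fin.
  pose b : R := (1 / (2 ^ j.+1)%:R / a)%R.
  have b0 : (0 < b)%R by rewrite !divr_gt0// ltr0n expn_gt0.
  exists (fun x => b * v x)%R; split.
  - exact: measurable_funM.
  - by move=> x; rewrite mulr_ge0// ltW.
  - under eq_integral do rewrite EFinM.
    rewrite ge0_integralZl//; last by rewrite lee_fin ltW.
      by rewrite -(fineK Ifin) -EFinM divfK// gt_eqF.
    by move=> x _; rewrite lee_fin.
  - under eq_integral do rewrite EFinM.
    rewrite ge0_integralZl//; last by rewrite lee_fin ltW.
      apply: (@le_trans _ _ (b%:E * (M%:E * a%:E))).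
        rewrite -!EFinM lee_fin /b /M.
        have p0 : ((2 ^ j.+1)%:R != 0 :> R)%R by rewrite pnatr_eq0 expn_eq0.
        have a_neq0 : (a != 0)%R by rewrite gt_eqF.
        move: ((2 ^ j.+1)%:R)%R p0 => p p0.
        have -> : (1 / p / a * (p * j.+1%:R * a) = j.+1%:R)%R.
          by field; rewrite a_neq0 p0.
        by rewrite ler_nat.
      by rewrite lee_pmul2l//; rewrite fineK// ltW.
    by move=> x _; rewrite lee_fin.
pose S x : \bar R := \sum_(j <oo) (v j x)%:E.
have v0 j x : (0 <= v j x)%R by have [_ ] := vP j.
have mv j : measurable_fun Omega (v j) by have [] := vP j.
have S0 x : 0 <= S x by apply: nneseries_ge0 => j _ _; rewrite lee_fin.
have mS : measurable_fun Omega S.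
  apply: (@ge0_emeasurable_sum _ _ _ _ _ xpredT) => [k x _ _|k _].
    by rewrite lee_fin.
  exact/measurable_EFinP.
have IS : \int[mu]_(x in Omega) S x < +oo.
  rewrite integral_nneseries//.
  - apply: (@le_lt_trans _ _ 1); last exact: ltry.
    apply: le_trans (epsilon_trick0 xpredT (@ler01 R)).
    apply: lee_nneseries => j *; last by have [_ _ ->] := vP j.
    by apply: integral_ge0 => x _; rewrite lee_fin.
  - by move=> j; exact/measurable_EFinP.
  - by move=> j x _; rewrite lee_fin.
have iS : mu.-integrable Omega S.
  apply/integrableP; split => //.
  by under eq_integral do rewrite gee0_abs//.
have Sfin := integrable_ae mO iS.
pose u x := fine (S x).
have u0 x : (0 <= u x)%R by rewrite fine_ge0.
have mu_ : measurable_fun Omega u by exact: measurableT_comp.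
have Iu : \int[mu]_(x in Omega) (u x)%:E < +oo.
  rewrite (@ge0_ae_eq_integral _ _ _ mu Omega _ S)//.
  - exact/measurable_EFinP.
  - by move=> x _; rewrite lee_fin.
  - by move: Sfin; apply: filterS => x /[apply]; exact: fineK.
have uv j : \int[mu]_(y in Omega') (v j (phi y))%:E <=
            \int[mu]_(y in Omega') (u (phi y))%:E.
  apply: ae_ge0_le_integral => //.
  - by move=> y _; rewrite lee_fin.
  - by apply/measurable_EFinP; exact: measurable_map_comp mmap (mv j).
  - by move=> y _; rewrite lee_fin.
  - by apply/measurable_EFinP; exact: measurable_map_comp mmap mu_.
  have := nonsingular_ae mO mO' mmap ns Sfin.
  apply: filterS => y /[apply] Sy; rewrite fineK//.
  rewrite /S (@nneseriesD1 _ _ j xpredT)// => [|k _]; last by rewrite lee_fin.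
  by rewrite leeDl// nneseries_ge0// => k _ _; rewrite lee_fin.
have := fin u mu_ u0 Iu; rewrite ltey => /eqP; apply; apply/eqyP => A A0.
apply: le_trans (uv (Num.truncn A).+1); have [_ _ _] := vP (Num.truncn A).+1.
by apply: le_trans; rewrite lee_fin ltW// truncnS_gt.
Qed.

End uniform_bound.

(** * Change of variables along the inverse map *)

Section change_of_variables.
Context (R : realType) (n : nat).
Notation E := 'rV[R]_n.
Notation mu := (@lebesgue_rV R n).
Variables (Omega1 Omega2 : set E) (phi : E -> E) (g : E -> R).
Hypotheses (mO1 : measurable Omega1) (mO2 : measurable Omega2).
Hypothesis mphi : measurable_map Omega1 Omega2 phi.
Hypothesis gRN : radon_nikodym_derivative Omega2 (pushforward_on Omega1 phi) g.
Hypothesis g0 : forall x, 0 <= g x.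
Local Open Scope ereal_scope.

Let mg : measurable_fun Omega2 (EFin \o g).
Proof. by have [? _ _] := gRN; exact/measurable_EFinP. Qed.

Import HBNNSimple.

(** On the level sets of simple functions this is the definition of the
    Radon-Nikodym derivative; monotone convergence does the rest. *)
Lemma ge0_change_of_variables (v : E -> \bar R) : measurable_fun Omega2 v ->
  (forall x, Omega2 x -> 0 <= v x) ->
  \int[mu]_(y in Omega1) v (phi y) = \int[mu]_(x in Omega2) (v x * (g x)%:E).
Proof.
move=> mv v0; pose v_ := nnsfun_approx mO2 mv.
have v_cvg x : Omega2 x -> (v_ j x)%:E @[j --> \oo] --> v x.
  by move=> Ox; exact: (cvg_nnsfun_approx mO2 mv v0).
have mphi' (w : E -> \bar R) : measurable_fun Omega2 w ->
    measurable_fun Omega1 (w \o phi) by exact: measurable_map_comp.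
transitivity (limn (fun j => \int[mu]_(y in Omega1) (v_ j (phi y))%:E)).
  rewrite -monotone_convergence//.
  - apply: eq_integral => y /[!inE] Oy; apply/esym/cvg_lim => //.
    by apply: v_cvg; exact: (mphi.2).
  - move=> j; apply: (mphi' (EFin \o v_ j)).
    by apply/measurable_EFinP; exact: measurable_funTS.
  - by move=> j y _; rewrite lee_fin.
  - by move=> y _ a b ab; rewrite lee_fin; exact/lefP/nd_nnsfun_approx.
transitivity (limn (fun j => \int[mu]_(x in Omega2) ((v_ j x)%:E * (g x)%:E)));
    last first.
  rewrite -monotone_convergence//.
  - apply: eq_integral => x /[!inE] Ox; apply/cvg_lim => //.
    by apply: cvgeZr => //; exact: v_cvg.
  - move=> j; apply: emeasurable_funM => //.
    by apply/measurable_EFinP; exact: measurable_funTS.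
  - by move=> j x _; rewrite mule_ge0 ?lee_fin.
  - move=> x _ a b ab; rewrite lee_wpmul2r ?lee_fin//.
    by exact/lefP/nd_nnsfun_approx.
congr (limn _); apply/funext => j.
have mA k : measurable (v_ j @^-1` [set k]) by [].
transitivity (\sum_(k \in range (v_ j))
    \int[mu]_(y in Omega1) (k * \1_(v_ j @^-1` [set k]) (phi y))%:E).
  under eq_integral do rewrite fimfunE -fsumEFin//.
  rewrite ge0_integral_fsum//.
  - move=> k; apply: (mphi' (fun x => (k * \1_(v_ j @^-1` [set k]) x)%:E)).
    by apply/measurable_EFinP; apply: measurable_funM.
  - by move=> k y _; rewrite nnfun_muleindic_ge0.
transitivity (\sum_(k \in range (v_ j))
    \int[mu]_(x in Omega2) ((k * \1_(v_ j @^-1` [set k]) x)%:E * (g x)%:E));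
    last first.
  rewrite -ge0_integral_fsum//.
  - apply: eq_integral => x _; rewrite fimfunE -fsumEFin// ge0_mule_fsuml// => k.
    by rewrite nnfun_muleindic_ge0.
  - move=> k; apply: emeasurable_funM => //.
    by apply/measurable_EFinP; apply: measurable_funM.
  - by move=> k x _; rewrite mule_ge0 ?nnfun_muleindic_ge0// lee_fin.
apply: eq_fsbigr => k /[!inE] -[x0 _ <-]; set A := _ @^-1` _.
under eq_integral do rewrite EFinM.
under [RHS]eq_integral do rewrite EFinM -muleA.
have vx0 : 0 <= (v_ j x0)%:E by rewrite lee_fin.
have mI : measurable_fun Omega2 (fun x => (\1_A x)%:E : \bar R).
  apply/measurable_EFinP; apply: (@measurable_indic _ E); exact: mA.
rewrite ge0_integralZl//; last exact: (mphi' _ mI).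
rewrite ge0_integralZl//; last 2 first.
  exact: emeasurable_funM.
  by move=> x _; rewrite mule_ge0 ?lee_fin.
congr (_ * _).
have mOA : measurable (Omega2 `&` A) by apply: measurableI => //; exact: mA.
have [_ _ gE] := gRN.
transitivity (mu (Omega1 `&` phi @^-1` (Omega2 `&` A))).
  set B := _ `&` _; have mB : measurable B.
    exact: mphi.1.
  rewrite (eq_integral (fun y => (\1_B y)%:E)).
    by rewrite integral_indic// /B setIAC setIid.
  move=> y /set_mem Oy; rewrite !indicE.
  suff -> : (phi y \in A) = (y \in B) by [].
  apply/idP/idP => /set_mem h; apply/mem_set; last exact: h.2.2.
  by split => //; split => //; exact: mphi.2.
rewrite [LHS]gE//.
rewrite integral_mkcondr; apply: eq_integral => x _.
by rewrite patchE indicE; case: ifPn => _; rewrite ?mul1e ?mul0e.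
Qed.

(** Holds without integrability: nonnegativity of g makes the positive and
    negative parts of w * g those of w multiplied by g, so both sides are the
    same difference of extended real integrals. *)
Lemma Rintegral_change_of_variables (w : E -> R) : measurable_fun Omega2 w ->
  (\int[mu]_(y in Omega1) w (phi y) = \int[mu]_(x in Omega2) (w x * g x))%R.
Proof.
move=> mw; congr fine; rewrite integralE [RHS]integralE.
have mw' : measurable_fun Omega2 (EFin \o w) by exact/measurable_EFinP.
congr (_ - _).
- transitivity (\int[mu]_(y in Omega1) ((EFin \o w)^\+ (phi y))).
    by apply: eq_integral => y _; rewrite !funeposE.
  rewrite (ge0_change_of_variables (measurable_funepos mw'))//.
  apply: eq_integral => x _; rewrite !funeposE/= -!EFin_max -EFinM.
  by rewrite maxr_pMl// mul0r.
- transitivity (\int[mu]_(y in Omega1) ((EFin \o w)^\- (phi y))).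
    by apply: eq_integral => y _; rewrite !funenegE.
  rewrite (ge0_change_of_variables (measurable_funeneg mw'))//.
  apply: eq_integral => x _; rewrite !funenegE/= -!EFin_max -EFinM.
  by rewrite maxr_pMl// mul0r mulNr.
Qed.

End change_of_variables.

(** * Composition operators and Riesz bases *)

Section riesz_composition.
Context (R : realType) (n : nat).
Notation E := 'rV[R]_n.
Notation mu := (@lebesgue_rV R n).
Implicit Types (Omega : set E) (phi : E -> E).

Lemma norm_L2_cvg0_le Omega Omega' (u w : nat -> E -> R) (C : R) : 0 <= C ->
  (forall N, (sqnorm Omega (u N) <= C%:E * sqnorm Omega' (w N))%E) ->
  norm_L2 Omega' (w N) @[N --> \oo] --> 0%E ->
  norm_L2 Omega (u N) @[N --> \oo] --> 0%E.
Proof.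
move=> C0 uw w0.
apply: (@squeeze_cvge _ _ _ _ (fun=> 0%E) _
  (fun N => (Num.sqrt C)%:E * norm_L2 Omega' (w N))%E).
- apply: nearW => N; rewrite norm_L2_ge0/=.
  by apply/norm_L2_le; rewrite ?sqrtr_ge0// sqr_sqrtr//; exact: uw.
- exact: cvg_cst.
- by rewrite -[0%E](mule0 (Num.sqrt C)%:E); exact: cvgeZl.
Qed.

(** F is the limit of its expansion along b, and the compositions with phi of
    the partial sums are bounded in L^2(Omega') uniformly in N, by the Bessel
    inequality for the orthonormal basis e. *)
Lemma riesz_comp_finite Omega Omega' b phi C (F : E -> R) :
  measurable Omega -> measurable Omega' -> measurable_map Omega' Omega phi ->
  nonsingular Omega' Omega phi -> riesz_basis Omega b ->
  bessel_bounded Omega' (fun k => b k \o phi) C -> L2 Omega F ->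
  (sqnorm Omega' (F \o phi) < +oo)%E.
Proof.
move=> mO mO' mphi ns [Lb [ Omega0 [e [U [oO0 [Le orthoe expe] bU [_ surjU] bE]]]]].
move=> [C0 upC] LF.
have mO0 : measurable Omega0 by exact: sub_sigma_algebra.
have [a La UaF] := surjU F LF.
pose c k := inner_L2 Omega0 a (e k).
have [K K0 UK] := bounded_operator_sqnorm bU.
have mS N : measurable_fun Omega (partial_sum c b N).
  by apply: L2_measurable => //; exact: L2_partial_sum.
have mF : measurable_fun Omega F by exact: L2_measurable.
have Lres N : L2 Omega0 (fun x => a x - partial_sum c e N x).
  have := L2_lincomb (-1) (L2_partial_sum mO0 c Le N) La.
  by congr L2; apply/funext => x; lra.
have cvS : norm_L2 Omega (fun x => F x - partial_sum c b N x) @[N --> \oo] --> 0%E.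
  apply: (norm_L2_cvg0_le (ltW K0) _ (expe a La)) => N.
  apply: le_trans (UK _ (Lres N)).
  rewrite (@eq_ae_sqnorm _ _ _ _ (U (fun x => a x - partial_sum c e N x)))//.
  - exact: measurable_funB.
  - by apply: L2_measurable => //; exact: (operator_L2 bU).
  have sumU := operator_partial_sum c N mO0 bU Le.
  have linU := operator_linear bU (-1) (L2_partial_sum mO0 c Le N) La.
  have -> : (fun x => a x - partial_sum c e N x) =
      -1 \*: partial_sum c e N \+ a.
    by apply/funext => x /=; rewrite scaleN1r addrC.
  move/ae_foralln : bE => bE.
  apply: filterS2 (filterI bE sumU) (filterI linU UaF) => x [h1 h2] [h3 h4] Ox.
  rewrite h3//= scaleN1r h4// h2// [RHS]addrC; congr (_ - _).
  by apply: eq_bigr => k _; rewrite h1.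
have upe : bessel_bounded Omega0 e 1.
  by split => // d N; rewrite mul1r sqnorm_orthonormal.
apply: (@le_lt_trans _ _ (C%:E * sqnorm Omega0 a)%E); last first.
  by rewrite lte_mul_pinfty ?lee_fin ?ltW// ltey_eq L2_sqnorm_fin_num.
apply: (sqnorm_comp_le mO mO' mphi ns mS mF cvS) => N.
apply: (le_trans (upC c N)); rewrite EFinM lee_pmul2l//.
by rewrite -[leRHS]mul1e; exact: bessel_inequality.
Qed.

(** Nonnegative functions are squares, so that finiteness in L^2 is finiteness
    of integrals of nonnegative functions. *)
Lemma riesz_comp_bound Omega Omega' b phi C :
  measurable Omega -> measurable Omega' -> measurable_map Omega' Omega phi ->
  nonsingular Omega' Omega phi -> riesz_basis Omega b ->
  bessel_bounded Omega' (fun k => b k \o phi) C ->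
  exists2 M : R, 0 < M &
    forall v : E -> R, measurable_fun Omega v -> (forall x, 0 <= v x) ->
      (\int[mu]_(y in Omega') (v (phi y))%:E <=
        M%:E * \int[mu]_(x in Omega) (v x)%:E)%E.
Proof.
move=> mO mO' mphi ns rb up; apply: comp_integral_bound => // v mv v0 vfin.
have sqv : (fun x => (Num.sqrt (v x) ^+ 2)%:E) = EFin \o v.
  by apply/funext => x; rewrite sqr_sqrtr.
have LF : L2 Omega (Num.sqrt \o v).
  apply/(L2P _ mO); split; last by rewrite /sqnorm/= sqv.
  exact: (measurableT_comp (continuous_measurable_fun (@sqrt_continuous R))).
have := riesz_comp_finite mO mO' mphi ns rb up LF.
by rewrite /sqnorm; under eq_integral do rewrite /= sqr_sqrtr//.
Qed.

Lemma riesz_basis_image Omega1 Omega2 b T :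
  riesz_basis Omega1 b -> bounded_operator Omega1 Omega2 T ->
  bijective_operator Omega1 Omega2 T ->
  riesz_basis Omega2 (fun k => T (b k)).
Proof.
move=> [Lb [ Omega0 [e [U [oO0 one bU [injU surjU] bE]]]]] bT [injT surjT].
have [Le _ _] := one.
have LU f : L2 Omega0 f -> L2 Omega1 (U f) by exact: (operator_L2 bU).
split; first by move=> k; exact: (operator_L2 bT).
exists Omega0, e, (T \o U); split => //.
- split.
  + by move=> f Lf; apply: (operator_L2 bT); exact: LU.
  + move=> f g Lf Lg fg; apply: (operator_ae bT); [exact: LU|exact: LU|].
    exact: (operator_ae bU).
  + move=> a f g Lf Lg.
    have LUfg : L2 Omega1 (a \*: U f \+ U g) by exact: L2_lincomb (LU _ Lf) (LU _ Lg).
    have Lfg : L2 Omega0 (a \*: f \+ g) by exact: L2_lincomb.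
    have := operator_linear bT a (LU _ Lf) (LU _ Lg).
    have := operator_ae bT (LU _ Lfg) LUfg (operator_linear bU a Lf Lg).
    by apply: filterS2 => x /= h1 h2 Ox; rewrite h1// h2.
  + have [C CP] := operator_bounded bU; have [D DP] := operator_bounded bT.
    exists (`|D| * C) => f Lf.
    apply: (le_trans (DP _ (LU f Lf))).
    apply: (@le_trans _ _ (`|D|%:E * norm_L2 Omega1 (U f))%E).
      by rewrite lee_wpmul2r ?norm_L2_ge0// lee_fin ler_norm.
    by rewrite EFinM -muleA lee_wpmul2l// CP.
- split.
  + move=> f g Lf Lg h; apply: injU => //; apply: injT => //; exact: LU.
  + move=> g Lg; have [f1 Lf1 f1g] := surjT g Lg.
    have [f Lf ff1] := surjU f1 Lf1; exists f => //.
    have := operator_ae bT (LU _ Lf) Lf1 ff1.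
    by move: f1g; apply: filterS2 => x /= h1 h2 Ox; rewrite h2// h1.
- by move=> k; apply: (operator_ae bT) => //; exact: LU.
Qed.

End riesz_composition.

(** * The weighted composition operator *)

Section weighted_composition.
Context (R : realType) (n : nat).
Notation E := 'rV[R]_n.
Notation mu := (@lebesgue_rV R n).

Lemma radon_nikodym_nonsingular (Omega1 Omega2 : set E) phi (g : E -> R) :
  measurable Omega2 ->
  radon_nikodym_derivative Omega2 (pushforward_on Omega1 phi) g ->
  nonsingular Omega1 Omega2 phi.
Proof.
move=> mO2 [mg _ gE] B mB BO B0; rewrite -[LHS]/(pushforward_on Omega1 phi B) gE//.
rewrite (ae_eq_integral (cst 0%E)) ?integral0//; last exact: ae_eq0.
by apply/measurable_EFinP; exact: (measurable_funS mO2 BO mg).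
Qed.

Variables (Omega1 Omega2 : set E) (h hinv : E -> E) (g : E -> R).
Hypotheses (mO1 : measurable Omega1) (mO2 : measurable Omega2).
Hypotheses (mh : measurable_map Omega2 Omega1 h)
  (mhinv : measurable_map Omega1 Omega2 hinv).
Hypothesis nsh : nonsingular Omega2 Omega1 h.
Hypothesis hhinv : ae_inverse Omega1 Omega2 h hinv.
Hypothesis gRN : radon_nikodym_derivative Omega2 (pushforward_on Omega1 hinv) g.
Hypothesis g0 : forall x, 0 <= g x.

Let nshinv : nonsingular Omega1 Omega2 hinv.
Proof. exact: radon_nikodym_nonsingular mO2 gRN. Qed.

Let mg : measurable_fun Omega2 g. Proof. by case: gRN. Qed.

Let T f := multiplication_operator g (composition_operator h f).

(** The zero set B of g has a null preimage under hinv.  Pulling this preimage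
    back by the non-singular h recovers B up to a null set. *)
Lemma radon_nikodym_neq0 : {ae mu, forall x, Omega2 x -> g x != 0}.
Proof.
have mB : measurable (Omega2 `&` g @^-1` [set 0]) by exact: mg.
have [_ _ gE] := gRN; have [hinvK _] := hhinv.
have B0 : mu (Omega1 `&` hinv @^-1` (Omega2 `&` g @^-1` [set 0])) = 0%E.
  rewrite -[LHS]/(pushforward_on Omega1 hinv _) gE//.
  by rewrite integral0_eq// => x [_ /= ->].
have mC : measurable (Omega1 `&` hinv @^-1` (Omega2 `&` g @^-1` [set 0])).
  exact: mhinv.1.
have hC : {ae mu, forall x, Omega2 x ->
    ~ (Omega1 `&` hinv @^-1` (Omega2 `&` g @^-1` [set 0])) (h x)}.
  apply: (nonsingular_ae mO1 mO2 mh nsh (P := fun y => ~ _ y)).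
  eexists; split; [exact: mC|exact: B0|] => y /= /not_implyP[_ /contrapT].
  exact.
move: hC hinvK; apply: filterS2 => x hx hK Ox; apply/eqP => gx0.
apply: (hx Ox); split; first exact: mh.2.
by rewrite /= hK.
Qed.

Lemma sqnorm_comp_inverse f : measurable_fun Omega1 f ->
  sqnorm Omega1 (f \o h \o hinv) = sqnorm Omega1 f.
Proof.
move=> mf; apply: eq_ae_sqnorm => //.
- apply: (measurable_map_comp mO2 mhinv); exact: (measurable_map_comp mO1 mh).
- by have [_] := hhinv; apply: filterS => y /= /[apply] ->.
Qed.

Lemma measurable_weighted f : measurable_fun Omega1 f ->
  measurable_fun Omega2 (T f).
Proof.
by move=> mf; apply: measurable_funM => //; exact: (measurable_map_comp mO1 mh).
Qed.

Lemma integral_density (v : E -> R) : measurable_fun Omega2 v ->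
  (forall x, 0 <= v x) ->
  (\int[mu]_(y in Omega1) (v (hinv y))%:E =
   \int[mu]_(x in Omega2) (v x * g x)%:E)%E.
Proof.
move=> mv v0; rewrite (ge0_change_of_variables mO1 mO2 mhinv gRN g0
  (v := EFin \o v))//.
  exact/measurable_EFinP.
by move=> x _; rewrite lee_fin.
Qed.

(** The operator f |-> g * (f \o h) is the adjoint of F |-> F \o hinv. *)
Lemma inner_L2_weighted f F : measurable_fun Omega1 f ->
  measurable_fun Omega2 F ->
  inner_L2 Omega2 F (T f) = inner_L2 Omega1 (F \o hinv) f.
Proof.
move=> mf mF; rewrite /inner_L2.
have mfh := measurable_map_comp mO1 mh mf.
transitivity (\int[mu]_(x in Omega2) ((F x * f (h x)) * g x)).
  by apply: eq_Rintegral => x _; rewrite /T /multiplication_operator/=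
    /composition_operator/= mulrA mulrAC.
rewrite -(Rintegral_change_of_variables mO1 mO2 mhinv gRN g0
  (w := fun x => F x * f (h x))); last exact: measurable_funM.
congr fine; apply: ae_eq_integral => //.
- apply/measurable_EFinP.
  apply: (measurable_map_comp mO2 mhinv (f := fun x => F x * f (h x))).
  exact: measurable_funM.
- apply/measurable_EFinP; apply: measurable_funM => //.
  exact: (measurable_map_comp mO2 mhinv).
- by have [_] := hhinv; apply: filterS => y /= /[apply] ->.
Qed.

Section bounds.
Variables (Mh Mi : R).
Hypotheses (Mh0 : 0 <= Mh) (Mi0 : 0 < Mi).
Hypothesis hM : forall v : E -> R, measurable_fun Omega1 v ->
  (forall y, 0 <= v y) ->
  (\int[mu]_(x in Omega2) (v (h x))%:E <= Mh%:E * \int[mu]_(y in Omega1) (v y)%:E)%E.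
Hypothesis iM : forall v : E -> R, measurable_fun Omega2 v ->
  (forall x, 0 <= v x) ->
  (\int[mu]_(y in Omega1) (v (hinv y))%:E <= Mi%:E * \int[mu]_(x in Omega2) (v x)%:E)%E.

(** One factor g of the integrand g^2 (f \o h)^2 is absorbed by the change of
    variables, the other one after the bound on composition with hinv. *)
Lemma sqnorm_weighted_le f : measurable_fun Omega1 f ->
  (sqnorm Omega2 (T f) <= Mi%:E * sqnorm Omega1 f)%E.
Proof.
move=> mf; have mfh := measurable_map_comp mO1 mh mf.
pose v x := g x * (f (h x)) ^+ 2.
have mfh2 : measurable_fun Omega2 (fun x => f (h x) ^+ 2).
  exact: measurable_funX.
have mv : measurable_fun Omega2 v by exact: measurable_funM.
have v0 x : 0 <= v x by rewrite mulr_ge0// sqr_ge0.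
have -> : sqnorm Omega2 (T f) = (\int[mu]_(x in Omega2) (v x * g x)%:E)%E.
  apply: eq_integral => x _; congr EFin.
  by rewrite /T /multiplication_operator /composition_operator /v/=; ring.
rewrite -integral_density//; apply: (le_trans (iM mv v0)).
rewrite lee_pmul2l//.
rewrite -(sqnorm_comp_inverse mf) /sqnorm.
rewrite (integral_density (v := fun x => f (h x) ^+ 2))//; last first.
  by move=> x; exact: sqr_ge0.
by under eq_integral do rewrite /v mulrC.
Qed.

Lemma weighted_L2 f : L2 Omega1 f -> L2 Omega2 (T f).
Proof.
move=> /(L2P _ mO1)[mf ffin]; apply/(L2P _ mO2); split.
  exact: measurable_weighted.
apply: (le_lt_trans (sqnorm_weighted_le mf)).
by rewrite lte_mul_pinfty ?lee_fin ?ltW.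
Qed.

Lemma weighted_bounded : bounded_operator Omega1 Omega2 T.
Proof.
split.
- exact: weighted_L2.
- move=> f f' Lf Lf' ff'; have := nonsingular_ae mO1 mO2 mh nsh ff'.
  apply: filterS => x /[apply] fh.
  by rewrite /T /multiplication_operator/= /composition_operator/= fh.
- move=> a f f' Lf Lf'; apply: aeW => x _.
  rewrite /T /multiplication_operator /composition_operator /=.
  by rewrite /GRing.scale/=; ring.
- exists (Num.sqrt Mi) => f Lf; apply/norm_L2_le; first exact: sqrtr_ge0.
  rewrite sqr_sqrtr; last exact: ltW.
  by apply: sqnorm_weighted_le; exact: (L2_measurable mO1).
Qed.

(** The inverse is G |-> (G / g) \o hinv.  That it lands in L^2(Omega1) means
    that G^2 / g is integrable over Omega2: as a composition of h with
    (G^2 / g) \o hinv, its integral is at most Mh times the integral of G^2.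
    Division by 0 only occurs on a null set. *)
Lemma weighted_bijective : bijective_operator Omega1 Omega2 T.
Proof.
have [hinvK hK] := hhinv; split.
  move=> f f' Lf Lf' TT.
  have fh : {ae mu, forall x, Omega2 x -> f (h x) = f' (h x)}.
    move: TT radon_nikodym_neq0; apply: filterS2 => x TT gx0 Ox.
    by apply: (mulfI (gx0 Ox)); exact: TT.
  move: (nonsingular_ae mO2 mO1 mhinv nshinv fh) hK.
  by apply: filterS2 => y + + Oy => /(_ Oy) + /(_ Oy) hy; rewrite hy.
move=> G LG; have mG := L2_measurable mO2 LG.
pose v x := G x ^+ 2 / g x.
have v0 x : 0 <= v x by rewrite divr_ge0// sqr_ge0.
have mV : measurable_fun Omega2 (fun x => (g x)^-1).
  (* Real powers are measurable; g is nonnegative and 0 `^ (-1) = 0 = 0^-1. *)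
  under eq_fun do rewrite -powR_inv1//.
  exact: (measurableT_comp (measurable_powR _)).
have mv : measurable_fun Omega2 v.
  by apply: measurable_funM => //; exact: measurable_funX.
have mGg : measurable_fun Omega2 (fun x => G x / g x).
  by apply: measurable_funM.
have vfin : (\int[mu]_(y in Omega1) (v (hinv y))%:E < +oo)%E.
  rewrite integral_density//; apply: le_lt_trans (((L2P _ mO2).1 LG).2).
  apply: ge0_le_integral => //.
  - by move=> x _; rewrite lee_fin mulr_ge0.
  - by apply/measurable_EFinP; exact: measurable_funM.
  - by apply/measurable_EFinP; exact: measurable_funX.
  move=> x _; rewrite lee_fin /v; have [->|gx] := eqVneq (g x) 0.
    by rewrite mulr0 sqr_ge0.
  by rewrite divfK.
exists ((fun x => G x / g x) \o hinv).
  apply/(L2P _ mO1); split; first exact: (measurable_map_comp mO2 mhinv).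
  rewrite /sqnorm (integral_density (v := fun x => (G x / g x) ^+ 2)); last 2 first.
    exact: measurable_funX.
    by move=> x; exact: sqr_ge0.
  have -> : (\int[mu]_(x in Omega2) ((G x / g x) ^+ 2 * g x)%:E =
      \int[mu]_(x in Omega2) (v (hinv (h x)))%:E)%E.
    apply: ge0_ae_eq_integral => //.
    - by apply/measurable_EFinP; apply: measurable_funM => //; exact: measurable_funX.
    - apply/measurable_EFinP; apply: (measurable_map_comp mO1 mh (f := v \o hinv)).
      exact: (measurable_map_comp mO2 mhinv).
    - by move=> x _; rewrite lee_fin mulr_ge0// sqr_ge0.
    - by move=> x _; rewrite lee_fin.
    move: hinvK radon_nikodym_neq0; apply: filterS2 => x hx gx Ox.
    rewrite hx// /v; congr EFin; have := gx Ox; move: (g x) => t t0; field; exact: t0.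
  have mvhinv : measurable_fun Omega1 (v \o hinv).
    exact: (measurable_map_comp mO2 mhinv).
    apply: (le_lt_trans (hM mvhinv (fun y => v0 (hinv y)))).
  by rewrite lte_mul_pinfty// lee_fin.
move: hinvK radon_nikodym_neq0; apply: filterS2 => x hx gx Ox.
rewrite /T /multiplication_operator/= /composition_operator/= hx//.
by rewrite mulrC divfK// gx.
Qed.

End bounds.

End weighted_composition.

(** * Almost everywhere representatives *)

Section dual.
Context (R : realType) (n : nat).
Notation E := 'rV[R]_n.
Notation mu := (@lebesgue_rV R n).

Lemma eq_ae_inner_L2 (Omega : set E) (f f' w : E -> R) : measurable Omega ->
  measurable_fun Omega f -> measurable_fun Omega f' -> measurable_fun Omega w ->
  f = f' %[ae mu in Omega] -> inner_L2 Omega f w = inner_L2 Omega f' w.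
Proof.
move=> mO mf mf' mw ff'; congr fine; apply: ae_eq_integral => //.
- by apply/measurable_EFinP; exact: measurable_funM.
- by apply/measurable_EFinP; exact: measurable_funM.
- by move: ff'; apply: filterS => x /[apply] ->.
Qed.

Lemma biorthogonal_dual_ae (Omega : set E) b psi psi' : measurable Omega ->
  (forall k, L2 Omega (b k)) ->
  (forall k, measurable_fun Omega (psi' k)) ->
  (forall k, psi k = psi' k %[ae mu in Omega]) ->
  biorthogonal_dual Omega b psi -> biorthogonal_dual Omega b psi'.
Proof.
move=> mO Lb mpsi' psiE [[Lpsi [ Omega' [e [U [oO' one bU bijU psiU]]]]] orth expand].
have mpsi k := L2_measurable mO (Lpsi k).
have innerE k f : L2 Omega f -> inner_L2 Omega (psi k) f = inner_L2 Omega (psi' k) f.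
  by move=> /(L2_measurable mO) mf; exact: eq_ae_inner_L2.
split.
- split.
  + move=> k; apply/(L2P _ mO); split => //.
    by rewrite -(eq_ae_sqnorm mO _ _ (psiE k))//; have /(L2P _ mO)[] := Lpsi k.
  + exists Omega', e, U; split => // k.
    by move: (psiE k) (psiU k); apply: filterS2 => x + + Ox => <-// ->.
- by move=> k m; rewrite -innerE.
- move=> f Lf; have := expand f Lf.
  rewrite (_ : (fun k => inner_L2 Omega f (psi k)) =
               (fun k => inner_L2 Omega f (psi' k)))//.
  by apply/funext => k; rewrite inner_L2C innerE// inner_L2C.
Qed.

Lemma bessel_bounded_ae (Omega : set E) b b' C : measurable Omega ->
  (forall k, measurable_fun Omega (b k)) ->
  (forall k, measurable_fun Omega (b' k)) ->
  (forall k, b k = b' k %[ae mu in Omega]) ->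
  bessel_bounded Omega b C -> bessel_bounded Omega b' C.
Proof.
move=> mO mb mb' bE [C0 up]; split => // c N.
have meas a : (forall k, measurable_fun Omega (a k)) ->
    measurable_fun Omega (partial_sum c a N).
  move=> ma; apply: measurable_sum => k; exact: measurable_funM.
rewrite -(@eq_ae_sqnorm _ _ _ (partial_sum c b N)) ?up//; [exact: meas..|].
move/ae_foralln : bE; apply: filterS => x bx Ox.
by apply: eq_bigr => k _; rewrite bx.
Qed.

End dual.

(** * The dual basis *)

Theorem theorem3p2 (R : realType) (n : nat) (Omega1 Omega2 : set 'rV[R]_n)
    (gamma gammad : nat -> 'rV[R]_n -> R) (h hinv : 'rV[R]_n -> 'rV[R]_n)
    (g : 'rV[R]_n -> R) :
  open Omega1 -> open Omega2 ->
  riesz_basis Omega1 gamma ->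
  biorthogonal_dual Omega1 gamma gammad ->
  measurable_map Omega2 Omega1 h ->
  nonsingular Omega2 Omega1 h ->
  riesz_basis Omega2 (fun k => composition_operator h (gamma k)) ->
  measurable_map Omega1 Omega2 hinv ->
  ae_inverse Omega1 Omega2 h hinv ->
  radon_nikodym_derivative Omega2 (pushforward_on Omega1 hinv) g ->
  biorthogonal_dual Omega2
    (fun k => composition_operator h (gamma k))
    (fun k => multiplication_operator g
                (composition_operator h (gammad k))).
Proof.
move=> oO1 oO2 rgamma [rgammad orth expand] mh nsh rhgamma mhinv hhinv gRN.
have mO1 : measurable Omega1 by exact: sub_sigma_algebra.
have mO2 : measurable Omega2 by exact: sub_sigma_algebra.
have [mg gpos gE] := gRN; have [hinvK hK] := hhinv.
have Lgamma := rgamma.1; have Lgammad := rgammad.1; have Lhgamma := rhgamma.1.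
have mgamma k := L2_measurable mO1 (Lgamma k).
have mgammad k := L2_measurable mO1 (Lgammad k).
have mhgamma k := L2_measurable mO2 (Lhgamma k).
pose g' x := Num.max (g x) 0.
have g'0 x : 0 <= g' x by rewrite le_max lexx orbT.
have mg' : measurable_fun Omega2 g' by exact: measurable_maxr.
have g'E : {ae @lebesgue_rV R n, forall x, Omega2 x -> g' x = g x}.
  by move: gpos; apply: filterS => x /[apply] gx; rewrite /g' max_l.
have g'RN : radon_nikodym_derivative Omega2 (pushforward_on Omega1 hinv) g'.
  split => //; first exact: aeW.
  move=> B mB BO; rewrite gE//; apply: ae_eq_integral => //.
  - by apply/measurable_EFinP; exact: (measurable_funS mO2 BO).
  - by apply/measurable_EFinP; exact: (measurable_funS mO2 BO).
  - by move: g'E; apply: filterS => x /[swap] /BO Ox /(_ Ox) ->.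
have nshinv := radon_nikodym_nonsingular mO2 gRN.
have [C1 up1] := riesz_basis_bessel_bounded mO1 rgamma.
have [C2 up2] := riesz_basis_bessel_bounded mO2 rhgamma.
(* Composition with h, then with hinv, is bounded.  The compositions of the
   C gamma_k with hinv are the gamma_k again, up to null sets. *)
have [Mh Mh0 hM] := riesz_comp_bound mO1 mO2 mh nsh rgamma up2.
have up1' : bessel_bounded Omega1
    (fun k => composition_operator h (gamma k) \o hinv) C1.
  apply: bessel_bounded_ae up1 => // k.
    exact: measurable_map_comp mO2 mhinv (mhgamma k).
  move: hK; apply: filterS => y /[apply] hy.
  by rewrite /composition_operator/= hy.
have [Mi Mi0 iM] := riesz_comp_bound mO2 mO1 mhinv nshinv rhgamma up1'.
(* From here on the nonnegative representative g' stands for g. *)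
apply: (biorthogonal_dual_ae (psi := fun k => multiplication_operator g'
  (composition_operator h (gammad k)))) => //.
- move=> k; apply: measurable_funM => //; exact: (measurable_map_comp mO1 mh).
- move=> k; move: g'E; apply: filterS => x /[apply] gx.
  by rewrite /multiplication_operator/= gx.
split.
- apply: (riesz_basis_image (T := fun f =>
    multiplication_operator g' (composition_operator h f)) rgammad).
  + exact: (weighted_bounded mO1 mO2 mh mhinv nsh hhinv g'RN g'0 Mi0 iM).
  + exact: (weighted_bijective mO1 mO2 mh mhinv nsh hhinv g'RN g'0 (ltW Mh0) hM).
- move=> k m; rewrite inner_L2C -(orth k m).
  rewrite (inner_L2_weighted mO1 mO2 mh mhinv hhinv g'RN g'0)//.
  rewrite [RHS]inner_L2C; apply: eq_ae_inner_L2 => //.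
    exact: measurable_map_comp mO2 mhinv (mhgamma m).
  move: hK; apply: filterS => y /[apply] hy.
  by rewrite /composition_operator/= hy.
move=> F LF; have mF := L2_measurable mO2 LF.
have Lf : L2 Omega1 (F \o hinv).
  apply/(L2P _ mO1); split; first exact: (measurable_map_comp mO2 mhinv).
  apply: (riesz_comp_finite mO2 mO1 mhinv nshinv rhgamma up1' LF).
pose c k := inner_L2 Omega1 (F \o hinv) (gammad k).
apply: (norm_L2_cvg0_le (ltW Mh0) _ (expand _ Lf)) => N.
have cE k : inner_L2 Omega2 F (multiplication_operator g'
    (composition_operator h (gammad k))) = c k.
  exact: (inner_L2_weighted mO1 mO2 mh mhinv hhinv g'RN g'0).
pose r y := (F \o hinv) y - partial_sum c gamma N y.
have mS : measurable_fun Omega1 (partial_sum c gamma N).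
  by apply: L2_measurable => //; exact: L2_partial_sum.
have mr : measurable_fun Omega1 r.
  by apply: measurable_funB => //; exact: measurable_map_comp mO2 mhinv mF.
have mr2 : measurable_fun Omega1 (fun y => r y ^+ 2) by exact: measurable_funX.
apply: le_trans (hM _ mr2 (fun y => sqr_ge0 _)).
rewrite -[leRHS]/(sqnorm Omega2 (r \o h)) (@eq_ae_sqnorm _ _ _ _ (r \o h))//.
- apply: measurable_funB => //; apply: measurable_sum => k.
  by apply: measurable_funM => //; exact: mhgamma.
- exact: measurable_map_comp mO1 mh mr.
move: hinvK; apply: filterS => x /[apply] hx.
rewrite /r/= hx; congr (_ - _); apply: eq_bigr => k _.
by rewrite cE.
Qed.
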